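(* Let $X$ be a random variable taking values in the $\sigma$-finite measure space $(\mathcal X,\mathscr X,\mu)$, with distribution $\mu_X\ll\mu$ and $$\Sigma_p(X):=\left\|\frac{\mathrm d\mu_X}{\mathrm d\mu}\right\|^{(\mu)}_{p/(p-1)}<\infty\quad\text{with } p\in[1,\infty).$$ Let $(\mathcal Y,\mathscr Y)$ be a measurable space and let $\rho\colon\mathcal X\times\mathcal Y\to[0,\infty]$ be a distortion function. Let $k\in(0,\infty)$ and suppose that $\mu$ is $\rho^{1/k}$-subregular of dimension $m\in(0,\infty)$ with subregularity constants $c\in(0,\infty)$ and $\delta_0\in(0,\infty]$. Then the following statements hold: (i) $\underline D_k(X)\ge m/p$. (ii) If $D_k(X)=m/p$ (i.e., the $k$-th quantization dimension exists and equals $m/p$), then $$\underline C_k(X)\ge c^{-\frac km}\,\Sigma_p^{-\frac{pk}{m}}(X)\,\frac{m}{m+pk}>0.$$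
   Context: All measures are positive, and $\sigma$-algebras contain all singletons. A distortion function $\rho\colon\mathcal X\times\mathcal Y\to[0,\infty]$ is a function measurable with respect to the product $\sigma$-algebra. $\log$ is the natural logarithm. For a distortion function $\varrho$ on $\mathcal X\times\mathcal Y$, a measure $\mu$ on $(\mathcal X,\mathscr X)$ is $\varrho$-subregular of dimension $m\in[0,\infty)$ with subregularity constants $c\in(0,\infty)$ and $\delta_0\in(0,\infty]$ if $\mu(\{x\in\mathcal X:\varrho(x,y)<\delta\})\le c\,\delta^m$ for all $y\in\mathcal Y$ and $\delta\in(0,\delta_0)$. $\|f\|_q^{(\mu)}=\left(\int|f|^q\,\mathrm d\mu\right)^{1/q}$ for $q\in(0,\infty)$, and $\|f\|_\infty^{(\mu)}$ is the $\mu$-essential supremum of $|f|$; for $p=1$, $p/(p-1)$ is read as $\infty$. $\Sigma_p^{a}(X)$ means $(\Sigma_p(X))^a$. $n$-th quantization error: $V_n(X)=\inf_{f}\mathbb E[\rho(X,f(X))]$ over all measurable $f\colon\mathcal X\to\mathcal Y$ with $|f(\mathcal X)|\le n$ (the infimum of the empty set is $\infty$). Lower and upper $k$-th quantization dimensions: $$\underline D_k(X)=\liminf_{n\to\infty}\frac{k\log n}{\log(1/V_n(X))},\qquad\overline D_k(X)=\limsup_{n\to\infty}\frac{k\log n}{\log(1/V_n(X))}.$$ Conventions: the quotient is $0$ if $V_n(X)=0$; if $\lim_{n\to\infty}V_n(X)>0$ (the limit exists by monotonicity), then $\underline D_k(X)=\overline D_k(X)=\infty$. If $\underline D_k(X)=\overline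 D_k(X)$, the common value is denoted $D_k(X)$ (the $k$-th quantization dimension). If $D_k(X)$ exists in $(0,\infty)$, the lower $k$-th quantization coefficient is $\underline C_k(X)=\liminf_{n\to\infty}n^{k/D_k(X)}V_n(X)$. *)

(* Defs.v *)
From HB Require Import structures.
From mathcomp Require Import all_boot all_order all_algebra.
From mathcomp Require Import all_classical all_reals all_analysis.
From mathcomp Require Import measurable_realfun.

Set Implicit Arguments.
Unset Strict Implicit.
Unset Printing Implicit Defensive.
Import Order.TTheory GRing.Theory Num.Theory.
Import numFieldNormedType.Exports.

Local Open Scope classical_set_scope.
Local Open Scope ring_scope.
Local Open Scope ereal_scope.

Definition singletons_measurable d (T : measurableType d) : Prop :=
  forall x : T, measurable [set x].

Section distortion.
Context d d' (T : measurableType d) (U : measurableType d') (R : realType).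
Implicit Type rho : T * U -> \bar R.

Definition distortion_function rho : Prop :=
  measurable_fun [set: T * U] rho /\ (forall z, 0 <= rho z).

Definition subregular rho (mu : {measure set T -> \bar R})
    (m c : R) (delta0 : \bar R) : Prop :=
  [/\ (0 <= m)%R, (0 < c)%R, 0 < delta0 &
      forall (y : U) (delta : R), (0 < delta)%R -> delta%:E < delta0 ->
        mu [set x | rho (x, y) < delta%:E] <= (c * delta `^ m)%:E].

End distortion.

Section sigma_norm.
Context d (T : measurableType d) dO (Omega : measurableType dO) (R : realType).

(* [hoelder_conjugate p%:E] is p / (p - 1), which is +oo when p = 1. *)
Definition Sigma_norm (mu : {sigma_finite_measure set T -> \bar R})
    (P : probability Omega R) (X : {RV P >-> T}) (p : R) : \bar R :=
  'N[mu]_(hoelder_conjugate p%:E)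
    [Radon_Nikodym (charge_of_finite_measure (distribution P X)) mu].

End sigma_norm.

Section quantization.
Context d d' dO (T : measurableType d) (U : measurableType d')
  (Omega : measurableType dO) (R : realType).
Variables (rho : T * U -> \bar R) (P : probability Omega R) (X : {RV P >-> T}).
Implicit Types (n : nat) (k : R).

Definition quantization_error n : \bar R :=
  ereal_inf [set \int[P]_w rho (X w, f (X w)) |
    f in [set f : T -> U | measurable_fun [set: T] f /\ (range f #<= `I_n)%card]].

(* When V_n = 1 or V_n = +oo the last branch takes the library's values of
   [inve] and [lne]; if V_n tends to 0, this concerns finitely many n only. *)
Definition quantization_quotient k n : \bar R :=
  if quantization_error n == 0 then 0
  else (k * ln n%:R)%:E / lne (quantization_error n)^-1.

Definition lower_quantization_dimension k : \bar R :=
  if 0 < limn quantization_error then +oo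
  else limn_einf (quantization_quotient k).

Definition upper_quantization_dimension k : \bar R :=
  if 0 < limn quantization_error then +oo
  else limn_esup (quantization_quotient k).

Definition has_quantization_dimension k : Prop :=
  lower_quantization_dimension k = upper_quantization_dimension k.

(* The common value, meaningful only under [has_quantization_dimension k]. *)
Definition quantization_dimension k : \bar R := lower_quantization_dimension k.

(* Meaningful only if the quantization dimension exists in ]0, +oo[. *)
Definition lower_quantization_coefficient k : \bar R :=
  limn_einf (fun n =>
    (n%:R `^ (k / fine (quantization_dimension k)))%:E * quantization_error n).

End quantization.

(* Main.v *)
Require Import Defs.
From HB Require Import structures.
From mathcomp Require Import all_boot all_order all_algebra.
From mathcomp Require Import all_classical all_reals all_analysis.
From mathcomp Require Import measurable_realfun ess_sup_inf.
From mathcomp Require Import ring lra.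

Set Implicit Arguments.
Unset Strict Implicit.
Unset Printing Implicit Defensive.
Import Order.TTheory GRing.Theory Num.Theory.
Import numFieldNormedType.Exports.

Local Open Scope classical_set_scope.
Local Open Scope ring_scope.
Local Open Scope ereal_scope.

(** The lower bound on the quantization error comes from the fact that [n]
    points of [U] have few points of [T] near them, and that [X] cannot charge
    a set of small measure too much.

    Fix a quantizer [f] with at most [n] values.  The event
    [rho (X, f X) < s] puts [X] in the union of at most [n] balls of radius
    [s `^ k^-1] for [rho `^ k^-1]; by subregularity this union has [mu]-measure
    at most [n * c * s `^ (m / k)] ([subregular_union_balls]).  Hoelder's
    inequality for the density of [X] against the indicator of that union
    ([distribution_le_Sigma_norm]) turns this into
    [P (rho (X, f X) < s) <= S * (n * c) `^ p^-1 * s `^ a], where [S] is the norm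
    of the density and [a = m / (p * k)] ([probability_distortion_lt]).

    Let [t] be the level [s] at which the right-hand side reaches 1.  Integrating
    the tail [1 - (s / t) `^ a] over [0, t] gives
    [E[rho (X, f X)] >= t * (a / (a + 1))] ([ge0_integral_ge_powR_cdf]), as long as
    the radii used stay below [delta0], which is the case for large [n] because
    [t] tends to 0.  Here [a / (a + 1) = m / (m + p * k)] and
    [t = (S `^ p * n * c) `^ (- (k / m))], so the error decreases no faster than
    [n `^ (- (k / m))], hence no faster than [n `^ (- (p * k / m))], with the
    constant [c `^ (- (k / m)) * S `^ (- (p * k / m)) * (m / (m + p * k))] in front
    ([near_quantization_error_ge]).  The coefficient bound is this estimate
    multiplied by [n `^ (p * k / m)], and the dimension bound follows by taking
    logarithms ([le_limn_einf_log_ratio]).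

    The constant is positive because the density of a probability measure cannot
    vanish almost everywhere ([Sigma_norm_gt0]). *)

(** * Hoelder's inequality on a set and the density of [X] *)

(** For [p = 1] the conjugate exponent is infinite and the norm is an essential
    supremum, for which the inequality is the trivial bound of an integral;
    otherwise it is Hoelder's inequality against the indicator of [A]. *)
Lemma set_integral_le_Lnorm d (T : measurableType d) (R : realType)
    (mu : {measure set T -> \bar R}) (g : T -> R) (p : R) (A : set T) :
  measurable_fun setT g -> (1 <= p)%R -> measurable A ->
  \int[mu]_(x in A) `|(g x)%:E| <=
    'N[mu]_(hoelder_conjugate p%:E)[EFin \o g] * mu A `^ p^-1.
Proof.
move=> mg; rewrite le_eqVlt => /predU1P[<-|p1] mA.
  rewrite hoelder_conjugate1 invr1 poweRe1// unlock.
  have [mu0|mu0] := ltP 0 (mu setT); last first.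
    rewrite mul0e null_set_integral//.
    - by apply/measurable_funTS/measurableT_comp => //; exact/measurable_EFinP.
    - by apply/eqP; rewrite eq_le measure_ge0 andbT (le_trans _ mu0)// le_measure ?inE.
  rewrite -integral_cst//; apply: ae_ge0_le_integral => //.
  - by apply/measurable_funTS/measurableT_comp => //; exact/measurable_EFinP.
  - move=> x _; apply: ess_sup_gee => //; by apply: aeW => y; exact: abse_ge0.
  - by apply: filterS (ess_sup_ge mu (abse \o (EFin \o g))) => x.
have p0 : (0 < p)%R by rewrite (lt_trans _ p1).
have p10 : (0 < p - 1)%R by rewrite subr_gt0.
have -> : hoelder_conjugate p%:E = (p / (p - 1))%:E.
  rewrite /hoelder_conjugate/= eqe gt_eqF// -EFinB inver.
  by rewrite gt_eqF.
have q0 : (0 < p / (p - 1))%R by rewrite divr_gt0.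
have mI : measurable_fun setT (\1_A : T -> R) by exact: measurable_indic.
have pq : ((p / (p - 1))^-1 + p^-1 = 1)%R.
  by field; rewrite !gt_eqF.
have := hoelder mu mg mI q0 p0 pq.
rewrite Lnorm1 [in X in _ <= _ * X -> _]unlock.
rewrite [X in X <= _ -> _](_ : _ = \int[mu]_(x in A) `|(g x)%:E|); last first.
  rewrite [RHS]integral_mkcond; apply: eq_integral => x _ /=.
  rewrite patchE indicE; case: ifPn => xA; first by rewrite mulr1.
  by rewrite mulr0 normr0.
congr (_ <= _ * (_ `^ _)).
rewrite -[in RHS](setIT A) -integral_indic//; apply: eq_integral => x _.
rewrite /= indicE normr_nat; case: (x \in A); first by rewrite powR1.
by rewrite powR0// gt_eqF.
Qed.

Section density.
Context d (T : measurableType d) dO (Omega : measurableType dO) (R : realType).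
Variables (mu : {sigma_finite_measure set T -> \bar R}) (P : probability Omega R)
  (X : {RV P >-> T}) (p : R).
Hypotheses (X_mu : distribution P X `<< mu) (p1 : (1 <= p)%R).

Lemma distribution_le_Sigma_norm A : measurable A ->
  distribution P X A <= Sigma_norm mu X p * mu A `^ p^-1.
Proof.
move=> mA; rewrite /Sigma_norm.
set g := Radon_Nikodym _ _.
have g_int : mu.-integrable setT g by exact: Radon_Nikodym_integrable.
have gE : g = EFin \o (fine \o g).
  by apply/funext => x /=; rewrite fineK// /g Radon_Nikodym_fin_num.
have mg : measurable_fun setT (fine \o g).
  by apply/measurable_EFinP; rewrite -gE; exact: measurable_int g_int.
have -> : distribution P X A = \int[mu]_(x in A) g x.
  exact: (Radon_Nikodym_integral (nu := charge_of_finite_measure (distribution P X))).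
rewrite [in leRHS]gE; apply: le_trans (set_integral_le_Lnorm mu mg p1 mA).
rewrite [in leLHS]gE; apply: le_trans (lee_abs _) _.
apply: le_abse_integral => //.
by apply/measurable_EFinP; exact: measurable_funTS.
Qed.

(** If the norm were zero, the Hoelder bound would make every set of finite
    measure negligible for [X], and countably many of them cover [T]. *)
Lemma Sigma_norm_gt0 : 0 < Sigma_norm mu X p.
Proof.
rewrite lt0e Lnorm_ge0 andbT; apply/eqP => S0.
have [F FT mF] := sigma_finiteT mu.
have F0 n : distribution P X (F n) = 0.
  apply/eqP; rewrite eq_le measure_ge0 andbT.
  by rewrite (le_trans (distribution_le_Sigma_norm (mF n).1))// S0 mul0e.
have : distribution P X setT <= 0.
  rewrite FT (le_trans (measure_sigma_subadditive _ _ _ (@subset_refl _ _)))//.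
  - by move=> n; exact: (mF n).1.
  - by apply: bigcup_measurable => n _; exact: (mF n).1.
  - by rewrite eseries0 // => n _ _; exact: F0.
by rewrite probability_setT lee_fin leNgt ltr01.
Qed.

End density.

(** * Integrating a tail of power type *)

Lemma continuous_at_powR (R : realType) (a x : R) : (0 < x)%R ->
  {for x, continuous (fun s : R => s `^ a)%R}.
Proof.
move=> x0; apply: (@differentiable_continuous _ _ _ x (fun s : R => s `^ a)%R).
by apply/derivable1_diffP; apply: derivable_powR; rewrite in_itv/= x0.
Qed.

Lemma cvg_at_right_powR (R : realType) (a x : R) : (0 < a)%R -> (0 <= x)%R ->
  (s `^ a)%R @[s --> x^'+] --> (x `^ a)%R.
Proof.
move=> a0; rewrite le_eqVlt => /predU1P[<-|x0].
  by rewrite powR0 ?gt_eqF//; exact: powR_cvg0.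
exact/cvg_at_right_filter/continuous_at_powR.
Qed.

Lemma continuous_within_powR (R : realType) (a t : R) : (0 < a)%R -> (0 < t)%R ->
  {within `[0%R, t], continuous (fun s : R => s `^ a)%R}.
Proof.
move=> a0 t0; apply/(continuous_within_itvP _ t0); split.
- by move=> x /[!in_itv]/= /andP[x0 _]; exact: continuous_at_powR.
- exact: cvg_at_right_powR.
- exact/cvg_at_left_filter/continuous_at_powR.
Qed.

(** [s - b / (a + 1) * s `^ (a + 1)] is an antiderivative; the condition
    [b * t `^ a = 1] says that [t] is the zero of the integrand. *)
Lemma integral_one_sub_powR (R : realType) (t a b : R) :
  (0 < t)%R -> (0 < a)%R -> (b * t `^ a = 1)%R ->
  \int[@lebesgue_measure R]_(s in `[0%R, t]) (1 - b * s `^ a)%:E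
    = (t * (a / (a + 1)))%:E.
Proof.
move=> t0 a0 bt.
have a10 : (0 < a + 1)%R by rewrite addr_gt0.
pose F (s : R) := (s - (b / (a + 1)) * s `^ (a + 1))%R.
have dF (x : R) : (0 < x)%R -> is_derive x 1%R F (1 - b * x `^ a)%R.
  move=> x0; have := is_derive1_powR (a + 1)%R x0; rewrite addrK => dp.
  have -> : (1 - b * x `^ a)%R = (1 - (b / (a + 1)) *: ((a + 1) * x `^ a))%R.
    by congr (_ - _)%R; rewrite /GRing.scale/=; field; rewrite gt_eqF.
  by apply: is_deriveB.
have cF : {within `[0%R, t], continuous F}.
  have cid : {within `[0%R, t], continuous (@id R)}.
    by apply: continuous_subspaceT => x; exact: cvg_id.
  move=> x; apply: cvgB; first exact: cid.
  by apply: cvgM; [exact: cvg_cst|exact: continuous_within_powR].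
rewrite (@continuous_FTC2 _ _ F)//.
- rewrite -EFinB /F powR0 ?gt_eqF// mulr0 subr0 subr0 powRD ?gt_eqF ?implyFb//.
  rewrite powRr1 ?ltW//; congr (_%:E).
  have -> : (b / (a + 1) * (t `^ a * t) = (b * t `^ a) * t / (a + 1))%R by ring.
  by rewrite bt; field; rewrite gt_eqF.
- move=> x; apply: cvgB; first exact: cvg_cst.
  by apply: cvgM; [exact: cvg_cst|exact: continuous_within_powR].
- move/(continuous_within_itvP _ t0) : cF => [_ F0 Ft]; split => //.
  by move=> x /[!in_itv]/= /andP[x0 _]; have [] := dF x x0.
- move=> x /[!in_itv]/= /andP[x0 _]; rewrite derive1E.
  by have /@derive_val := dF x x0.
Qed.

(** The expectation is the integral of the tail [P (h > s)]; truncating [h] at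
    [t] makes it real-valued and costs nothing, since only the tail on [0, t] is
    used. *)
Lemma ge0_integral_ge_powR_cdf dO (Omega : measurableType dO) (R : realType)
    (P : probability Omega R) (h : Omega -> \bar R) (t a b : R) :
  measurable_fun setT h -> (forall w, 0 <= h w) ->
  (0 < t)%R -> (0 < a)%R -> (b * t `^ a = 1)%R ->
  (forall s, (0 < s < t)%R -> P [set w | h w < s%:E] <= (b * s `^ a)%:E) ->
  (t * (a / (a + 1)))%:E <= \int[P]_w h w.
Proof.
move=> mh h0 t0 a0 bt hP.
have b0 : (0 < b)%R by rewrite -(pmulr_lgt0 b (powR_gt0 a t0)) bt.
pose Z w := fine (mine (h w) t%:E).
have ZE w : (Z w)%:E = mine (h w) t%:E.
  rewrite fineK// ge0_fin_numE; first by rewrite gt_min ltry orbT.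
  by rewrite le_min h0 lee_fin ltW.
have mZ : measurable_fun setT Z.
  by apply: measurableT_comp => //; exact: measurable_mine.
pose Zm : {mfun Omega >-> R} := HB.pack Z (isMeasurableFun.Build _ _ _ _ Z mZ).
pose ZR : {RV P >-> R} := Zm.
have Z0 w : (0 <= ZR w)%R by rewrite -lee_fin ZE le_min h0 lee_fin ltW.
apply: (@le_trans _ _ 'E_P[ZR]); last first.
  rewrite expectation_def; apply: ge0_le_integral => //.
  - by move=> w _; rewrite lee_fin.
  - exact/measurable_EFinP.
  - by move=> w _; rewrite [leLHS]ZE ge_min lexx.
rewrite ge0_expectation_ccdf// -(integral_one_sub_powR t0 a0 bt).
have msub : measurable_fun setT (fun s : R => (1 - b * s `^ a)%:E).
  apply/measurable_EFinP; apply: measurable_funB => //.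
  by apply: measurable_funM => //; exact: measurable_powR.
apply: (@le_trans _ _ (\int[@lebesgue_measure R]_(s in `[0%R, t]) ccdf ZR s)); last first.
  apply: ge0_subset_integral => //.
  - by apply: measurable_funTS; exact: ccdf_measurable.
  - by move=> s; rewrite /= !in_itv/= => /andP[->].
have bs1 s : (0 <= s <= t)%R -> (b * s `^ a <= 1)%R.
  by move=> /andP[s0 st]; rewrite -bt ler_pM2l// ge0_ler_powR ?nnegrE// ltW.
apply: ge0_le_integral => //.
- by move=> s; rewrite /= in_itv/= => /bs1 ?; rewrite lee_fin subr_ge0.
- exact: measurable_funTS.
- by apply: measurable_funTS; exact: ccdf_measurable.
move=> s; rewrite /= in_itv/= => /andP[s0].
rewrite le_eqVlt => /predU1P[->|st]; first by rewrite bt subrr.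
(* The tail at [s] involves the non-strict event [h <= s], whereas the hypothesis
   bounds the strict events [h < x]: let [x] decrease to [s]. *)
rewrite ccdf_1_cdf EFinB leeD2l// leeN2 -[leLHS]fineK ?fin_num_measure// lee_fin.
have cvg_bs : (b * x `^ a)%R @[x --> s^'+] --> (b * s `^ a)%R.
  by apply: cvgM; [exact: cvg_cst|exact: cvg_at_right_powR].
apply: (cvgr_to_ge cvg_bs); near=> x.
have sx : (s < x)%R by near: x; exact: nbhs_right_gt.
have xt : (x < t)%R by near: x; exact: nbhs_right_lt.
rewrite -lee_fin fineK ?fin_num_measure//.
have x0 : (0 < x)%R by exact: le_lt_trans sx.
apply: le_trans (hP x _); last by rewrite x0.
rewrite /cdf /distribution /pushforward; apply: le_measure; rewrite ?inE.
- by rewrite -[X in measurable X]setTI; have := mZ; apply.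
- rewrite -[X in measurable X]setTI.
  exact: emeasurable_fun_infty_o.
move=> w; rewrite /= in_itv/= -lee_fin ZE ge_min !lee_fin.
by rewrite (leNgt t) st orbF => /le_lt_trans; apply; rewrite lte_fin.
Unshelve. all: by end_near. Qed.

(** * Lower bound on the quantization error *)

Lemma subregular_union_balls d d' (T : measurableType d) (U : measurableType d')
    (R : realType) (rho : T * U -> \bar R) (mu : {measure set T -> \bar R})
    (m c : R) (delta0 : \bar R) (f : T -> U) (n : nat) (delta : R) :
  measurable_fun setT rho -> subregular rho mu m c delta0 ->
  measurable_fun setT f -> (range f #<= `I_n)%card ->
  (0 < delta)%R -> delta%:E < delta0 ->
  mu [set x | rho (x, f x) < delta%:E] <= (n%:R * (c * delta `^ m))%:E.
Proof.
move=> mrho [_ c0 _ mu_ball] mf /pcard_surjP[y ysurj] d0 dd0.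
have mball u : measurable [set x | rho (x, u) < delta%:E].
  rewrite -[X in measurable X]setTI; apply: emeasurable_fun_infty_o => //.
  exact: measurableT_comp (pair2_measurable u).
have mA : measurable [set x | rho (x, f x) < delta%:E].
  rewrite -[X in measurable X]setTI; apply: emeasurable_fun_infty_o => //.
  by apply: measurableT_comp => //; exact: measurable_fun_pair.
apply: (@le_trans _ _ (mu (\big[setU/set0]_(i < n) [set x | rho (x, y i) < delta%:E]))).
  apply: le_measure; rewrite ?inE//; first exact: bigsetU_measurable.
  move=> x /= rx; rewrite -(bigcup_mkord n (fun i => [set x | rho (x, y i) < delta%:E])).
  have [i /= In yi] := ysurj (f x) (imageT f x).
  by exists i => //=; rewrite yi.
apply: le_trans (Boole_inequality _ (A := fun i => [set x | rho (x, y i) < delta%:E]) _) _.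
  by move=> i _; exact: mball.
apply: (@le_trans _ _ (\sum_(i < n) (c * delta `^ m)%:E)).
  by apply: lee_sum => i _; exact: mu_ball.
by rewrite sumEFin sumr_const card_ord -[X in X%:E <= _]mulr_natl lexx.
Qed.

Section quantization_error.
Context d d' dO (T : measurableType d) (U : measurableType d')
  (Omega : measurableType dO) (R : realType).
Variables (mu : {sigma_finite_measure set T -> \bar R}) (P : probability Omega R)
  (X : {RV P >-> T}) (p : R) (rho : T * U -> \bar R) (k m c : R) (delta0 : \bar R).
Hypotheses (X_mu : distribution P X `<< mu) (p1 : (1 <= p)%R)
  (Sigma_fin : Sigma_norm mu X p < +oo) (rho_dist : distortion_function rho)
  (k0 : (0 < k)%R) (m0 : (0 < m)%R)
  (mu_subreg : subregular (fun z => rho z `^ k^-1) mu m c delta0).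

Let S := fine (Sigma_norm mu X p).

Let SE : Sigma_norm mu X p = S%:E.
Proof. by rewrite fineK// ge0_fin_numE// Lnorm_ge0. Qed.

Let S0 : (0 < S)%R.
Proof. by rewrite -lte_fin -SE Sigma_norm_gt0. Qed.

Let c0 : (0 < c)%R. Proof. by have [] := mu_subreg. Qed.

Let p0 : (0 < p)%R. Proof. exact: lt_le_trans p1. Qed.

(** The union bound is applied to [mu] rather than to the law of [X], so that the
    number [n] of balls enters under the root. *)
Lemma probability_distortion_lt (f : T -> U) n (s : R) :
  measurable_fun setT f -> (range f #<= `I_n)%card ->
  (0 < s)%R -> (s `^ k^-1)%:E < delta0 ->
  P [set w | rho (X w, f (X w)) < s%:E] <=
    (S * (n%:R * c) `^ p^-1 * s `^ (m / (p * k)))%:E.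
Proof.
have [mrho rho0] := rho_dist.
move=> mf fn s0 sd.
have sk0 : (0 < s `^ k^-1)%R by exact: powR_gt0.
have mrhok : measurable_fun setT (fun z => rho z `^ k^-1).
  exact: measurableT_comp (measurable_poweR _) mrho.
pose A := [set x | rho (x, f x) `^ k^-1 < (s `^ k^-1)%:E].
have mA : measurable A.
  rewrite -[A]setTI; apply: emeasurable_fun_infty_o => //.
  by apply: (measurableT_comp mrhok); exact: measurable_fun_pair.
have muA := subregular_union_balls mrhok mu_subreg mf fn sk0 sd.
apply: (@le_trans _ _ (distribution P X A)).
  apply: le_measure; rewrite ?inE.
  - rewrite -[X in measurable X]setTI; apply: emeasurable_fun_infty_o => //.
    apply: measurableT_comp => //; apply: measurable_fun_pair => //.
    exact: measurableT_comp.
  - by rewrite -[X in measurable X]setTI; exact: measurable_funPT.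
  move=> w; rewrite /= /A /= -poweR_EFin => rs.
  rewrite lt_neqAle; apply/andP; split.
    apply/eqP => /(congr1 (fun x => x `^ k)).
    rewrite -!poweRrM mulVf ?gt_eqF// !poweRe1 ?rho0 ?lee_fin ?(ltW s0)//.
    by move=> rsE; rewrite rsE ltxx in rs.
  apply: gt0_ler_poweR (ltW rs) => //; rewrite ?invr_ge0 ?in_itv/= ?leey ?andbT ?lee_fin ?(ltW k0) ?(ltW s0)//.
apply: le_trans (distribution_le_Sigma_norm X_mu p1 mA) _.
rewrite SE -mulrA EFinM lee_pmul2l// ?lte_fin//.
have nc0 : (0 <= n%:R * c)%R by rewrite mulr_ge0// ltW.
have -> : ((n%:R * c) `^ p^-1 * s `^ (m / (p * k)))%R =
    ((n%:R * (c * (s `^ k^-1) `^ m)) `^ p^-1)%R.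
  rewrite mulrA [in RHS]powRM ?powR_ge0// -!powRrM; congr (_ * _ `^ _)%R.
  by field; rewrite !gt_eqF.
rewrite -poweR_EFin; apply: gt0_ler_poweR muA => //; rewrite ?invr_ge0 ?(ltW p0)// in_itv/= leey andbT ?measure_ge0//.
by rewrite lee_fin mulrA mulr_ge0// powR_ge0.
Qed.


(** [t] is the level [s] at which the bound of [probability_distortion_lt] equals 1. *)
Lemma quantization_error_ge n (t := ((S `^ p * (n%:R * c)) `^ (- (k / m)))%R) :
  (0 < n)%N -> (t `^ k^-1)%:E <= delta0 ->
  (t * (m / (m + p * k)))%:E <= quantization_error rho X n.
Proof.
move=> n0 td; have [mrho rho0] := rho_dist.
have nc0 : (0 < n%:R * c)%R by rewrite mulr_gt0// ltr0n.
have t0 : (0 < t)%R by rewrite powR_gt0// mulr_gt0// powR_gt0.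
have a0 : (0 < m / (p * k))%R by rewrite divr_gt0// mulr_gt0.
have bt : (S * (n%:R * c) `^ p^-1 * t `^ (m / (p * k)) = 1)%R.
  rewrite /t -powRrM.
  have -> : (- (k / m) * (m / (p * k)) = - p^-1)%R.
    by field; rewrite !gt_eqF.
  rewrite powRN (powRM _ (powR_ge0 S p) (ltW nc0)) -powRrM mulfV ?gt_eqF// powRr1 ?ltW//.
  by rewrite divff// gt_eqF// mulr_gt0// powR_gt0.
have -> : (m / (m + p * k) = (m / (p * k)) / (m / (p * k) + 1))%R.
  by field; rewrite !gt_eqF// ?addr_gt0 ?mulr_gt0.
apply: le_ereal_inf_tmp => _ [f [mf fn] <-].
apply: (ge0_integral_ge_powR_cdf _ _ t0 a0 bt) => //.
  apply: measurableT_comp => //; apply: measurable_fun_pair => //.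
  exact: measurableT_comp.
move=> s /andP[s0 st]; apply: probability_distortion_lt => //.
apply: lt_le_trans td; rewrite lte_fin.
by rewrite gt0_ltr_powR ?invr_gt0 ?nnegrE// ltW.
Qed.

(** Two things happen for large [n]: the radius [t `^ k^-1] drops below
    [delta0], and [n `^ (- (k / m))] is weakened to [n `^ (- (p * k / m))], which
    is smaller since [p >= 1]. *)
Lemma near_quantization_error_ge :
  \forall n \near \oo,
    (c `^ (- (k / m)) * S `^ (- (p * k / m)) * (m / (m + p * k)) *
      n%:R `^ (- (p * k / m)))%:E <= quantization_error rho X n.
Proof.
have d0 : 0 < delta0 by have [] := mu_subreg.
(* [delta0] may be infinite: any positive real not above it serves as threshold. *)
have [r r0 rd] : exists2 r : R, (0 < r)%R & r%:E <= delta0.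
  case: delta0 d0 => [r||]// r0; last by exists 1%R => //; exact: leey.
  by exists r.
have Sp0 : (0 < S `^ p)%R by exact: powR_gt0.
near=> n.
have n0 : (0 < n)%N by near: n; exists 1%N.
have nR0 : (0 < n%:R :> R)%R by rewrite ltr0n.
have ny : (r `^ (- m) / (S `^ p * c) <= n%:R)%R.
  by near: n; exact: nbhs_infty_ger.
have y0 : (0 < S `^ p * (n%:R * c))%R by rewrite !mulr_gt0.
apply: le_trans (quantization_error_ge n0 _); last first.
  apply: le_trans rd; rewrite lee_fin -powRrM.
  have -> : (- (k / m) * k^-1 = - m^-1)%R by field; rewrite !gt_eqF.
  rewrite ler_pdivrMr ?mulr_gt0// in ny.
  have -> : r = ((r `^ (- m)) `^ (- m^-1))%R.
    by rewrite -powRrM mulrNN mulfV ?gt_eqF// powRr1// ltW.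
  rewrite !powRN lef_pV2 ?posrE ?powR_gt0 ?invr_gt0 ?powR_gt0//.
  rewrite ge0_ler_powR ?nnegrE ?invr_ge0 ?powR_ge0 ?(ltW m0) ?(ltW y0)//.
  by rewrite -powRN mulrCA.
rewrite lee_fin mulrAC ler_pM2r ?divr_gt0 ?addr_gt0 ?mulr_gt0//.
rewrite powRM ?(ltW Sp0) ?mulr_ge0 ?(ltW c0)// powRM ?(ltW c0)// -powRrM.
have -> : (p * - (k / m) = - (p * k / m))%R by ring.
rewrite (mulrC (n%:R `^ _)%R) mulrA (mulrC (S `^ _)%R).
rewrite ler_pM2l ?mulr_gt0 ?powR_gt0// ler_powR ?ler1n// lerN2 -mulrA.
by rewrite ler_peMl// divr_ge0// ltW.
Unshelve. all: by end_near. Qed.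

End quantization_error.

(** * From the rate to the dimension and the coefficient *)

Lemma quantization_error_nonincreasing d d' dO (T : measurableType d)
    (U : measurableType d') (Omega : measurableType dO) (R : realType)
    (rho : T * U -> \bar R) (P : probability Omega R) (X : {RV P >-> T}) :
  {homo quantization_error rho X : n q / (n <= q)%N >-> q <= n}.
Proof.
move=> n q nq; apply: ereal_inf_le_tmp => _ [f [mf fn] <-]; exists f => //.
split=> //; apply: card_le_trans fn _; apply: subset_card_le => i /= /leq_trans.
exact.
Qed.

Lemma limn_einf_ge (R : realType) (u : nat -> \bar R) (l : \bar R) :
  (\forall n \near \oo, l <= u n) -> l <= limn_einf u.
Proof.
move=> lu; rewrite limn_einf_lim; apply: lime_ge; first exact: is_cvg_einfs.
case: lu => N _ lu; exists N => // n /= Nn.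
apply: le_ereal_inf_tmp => _ [j /= nj <-].
by apply: lu => /=; exact: leq_trans nj.
Qed.

(** Since [log (1 / V n)] is positive and at most [b * log n - log C], the
    quotient is at least [k * log n / (b * log n - log C)], which tends to
    [k / b]. *)
Lemma le_limn_einf_log_ratio (R : realType) (V : nat -> \bar R) (k b C : R) :
  (0 < k)%R -> (0 < b)%R -> (0 < C)%R ->
  (\forall n \near \oo, (C * n%:R `^ (- b))%:E <= V n) ->
  (\forall n \near \oo, V n < 1) ->
  (k / b)%:E <= limn_einf (fun n =>
    if V n == 0 then 0 else (k * ln n%:R)%:E / lne (V n)^-1).
Proof.
move=> k0 b0 C0 VC V1; apply/lee_subgt0Pr => e e0; apply: limn_einf_ge.
pose r := (k / b - e)%R.
near=> n.
have n0 : (0 < n)%N by near: n; exists 1%N.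
have nR0 : (0 < n%:R :> R)%R by rewrite ltr0n.
have VCn : (C * n%:R `^ (- b))%:E <= V n by near: n.
have Cn0 : (0 < C * n%:R `^ (- b))%R by rewrite mulr_gt0// powR_gt0.
have Vn0 : 0 < V n by apply: lt_le_trans VCn; rewrite lte_fin.
have Vn1 : V n < 1 by near: n.
rewrite gt_eqF// -EFinB -/r.
move: VCn Vn0 Vn1; case: (V n) => [v| |]//; rewrite lee_fin !lte_fin => Cv v0 v1.
have lnv0 : (0 < - ln v)%R by rewrite oppr_gt0 ln_lt0// v0.
have lnv : (- ln v <= - ln C + b * ln n%:R)%R.
  have : (ln (C * n%:R `^ (- b)) <= ln v)%R by rewrite ler_ln// posrE.
  by rewrite lnM ?posrE// ?powR_gt0// ln_powR; lra.
rewrite inver gt_eqF// lne_EFin ?invr_gt0// lnV// inver gt_eqF// -EFinM lee_fin.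
rewrite ler_pdivlMr//.
have lnn0 : (0 <= ln n%:R :> R)%R by rewrite ln_ge0// ler1n.
have [r0|r0] := lerP r 0.
  apply: (@le_trans _ _ 0%R); last by rewrite mulr_ge0// ltW.
  by rewrite mulr_le0_ge0// ltW.
apply: (@le_trans _ _ (r * (- ln C + b * ln n%:R)))%R; first by rewrite ler_pM2l.
have -> : (k = r * b + e * b)%R by rewrite /r; field; rewrite gt_eqF.
(* With [r = k / b - e], the inequality [r * (b * log n - log C) <= k * log n]
   amounts to [- r * log C <= e * b * log n]. *)
have : (- (r * ln C) / (e * b) <= ln n%:R)%R.
  by rewrite -ler_expR lnK ?posrE//; near: n; exact: nbhs_infty_ger.
rewrite ler_pdivrMr ?mulr_gt0//; lra.
Unshelve. all: by end_near. Qed.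

Theorem corollary4p1 (R : realType) (d d' dO : measure_display)
    (T : measurableType d) (U : measurableType d') (Omega : measurableType dO)
    (T1 : singletons_measurable T) (U1 : singletons_measurable U)
    (mu : {sigma_finite_measure set T -> \bar R})
    (P : probability Omega R) (X : {RV P >-> T})
    (X_mu : distribution P X `<< mu)
    (p : R) (p1 : (1 <= p)%R) (Sigma_fin : Sigma_norm mu X p < +oo)
    (rho : T * U -> \bar R) (rho_dist : distortion_function rho)
    (k m c : R) (delta0 : \bar R) (k0 : (0 < k)%R) (m0 : (0 < m)%R)
    (mu_subreg : subregular (fun z => rho z `^ k^-1) mu m c delta0) :
  (m / p)%:E <= lower_quantization_dimension rho X k /\
  (has_quantization_dimension rho X k ->
   quantization_dimension rho X k = (m / p)%:E ->
   (c `^ (- (k / m)))%:E * Sigma_norm mu X p `^ (- (p * k / m)) *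
     (m / (m + p * k))%:E <= lower_quantization_coefficient rho X k /\
   0 < (c `^ (- (k / m)))%:E * Sigma_norm mu X p `^ (- (p * k / m)) *
     (m / (m + p * k))%:E).
Proof.
have c0 : (0 < c)%R by have [] := mu_subreg.
have p0 : (0 < p)%R by exact: lt_le_trans p1.
have Vge := near_quantization_error_ge X_mu p1 Sigma_fin rho_dist k0 m0 mu_subreg.
have SE : Sigma_norm mu X p = (fine (Sigma_norm mu X p))%:E.
  by rewrite fineK// ge0_fin_numE// Lnorm_ge0.
have S0 : (0 < fine (Sigma_norm mu X p))%R.
  by rewrite -lte_fin -SE Sigma_norm_gt0.
move: Vge S0; rewrite SE poweR_EFin -!EFinM /=; set S := fine _.
set C := (_ * (m / _))%R => Vge S0.
have C0 : (0 < C)%R.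
  by rewrite !mulr_gt0 ?powR_gt0// invr_gt0 addr_gt0// mulr_gt0.
split.
  rewrite /lower_quantization_dimension; case: ifPn => [_|]; first exact: leey.
  rewrite -leNgt => V0.
  have -> : (m / p = k / (p * k / m))%R by field; rewrite !gt_eqF.
  apply: (le_limn_einf_log_ratio k0 _ C0 Vge).
    by rewrite divr_gt0// mulr_gt0.
  have /ereal_inf_lt[_ [N _ <-] VN] :
      ereal_inf (range (quantization_error rho X)) < 1.
    rewrite -(cvg_lim _ (ereal_nonincreasing_cvgn
      (quantization_error_nonincreasing rho X)))//.
    exact: le_lt_trans V0 _.
  by exists N => // n /= Nn; apply: le_lt_trans VN; exact: quantization_error_nonincreasing.
move=> _ dimE; split; last by rewrite lte_fin.
apply: limn_einf_ge; rewrite dimE /=.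
have -> : (k / (m / p) = p * k / m)%R by field; rewrite !gt_eqF.
near=> n.
have n0 : (0 < n%:R `^ (p * k / m) :> R)%R.
  by rewrite powR_gt0// ltr0n; near: n; exists 1%N.
have -> : C%:E = (n%:R `^ (p * k / m))%:E * (C * n%:R `^ (- (p * k / m)))%:E.
  by rewrite -EFinM powRN; congr (_%:E); field; rewrite gt_eqF.
by rewrite lee_pmul2l// ?lte_fin//; near: n.
Unshelve. all: by end_near. Qed.
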